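(* Let $m$ and $n$ be relatively prime positive integers such that each group of order $mn$ has a normal subgroup of order $m$. Let $N=N_1\rtimes_\sigma N_2$, with $|N_1|=m$, $N_1$ abelian, $|N_2|=n$, where $\sigma:N_2\to\operatorname{Aut}N_1$ is a group morphism. Let $B_1$ be a skew brace with additive group (identified with) $N_1$, let $B_2$ be a skew brace with additive group (identified with) $N_2$, and let $\{(a,\lambda_a):a\in N_1\}$ and $\{(b,\lambda_b):b\in N_2\}$ be the corresponding regular subgroups of $\operatorname{Hol}(N_1)$ and $\operatorname{Hol}(N_2)$, respectively. Let $\tau:(B_2,\circ)\to\operatorname{Aut}(B_1,\cdot)$ be a group morphism. Assume further $$\sigma(b)\lambda_a=\lambda_a\sigma(b)\quad\forall a\in N_1,\ b\in N_2,$$ $$\sigma(b\,\lambda_b(c)\,b^{-1})=\tau(b)\sigma(c)\tau(b)^{-1}\quad\forall b,c\in N_2.$$ Let $\alpha:N_1\to N_1$, $a\mapsto\alpha_a$, be a map satisfying $$\alpha_{a\circ a'}=\alpha_a\lambda_a(\alpha_{a'})\quad\forall a,a'\in N_1,$$ and, writing $A_b:=\tau(b)(a\alpha_a)\cdot\sigma(b)^{-1}\tau(b)(\alpha_a^{-1})\in N_1$ (which depends on both $a$ and $b$), $$\alpha_{A_b}=\sigma(b)^{-1}\tau(b)(\alpha_a)\quad\forall (a,b)\in N,$$ $$\lambda_{A_b}=\sigma(b)^{-1}\tau(b)\lambda_a\tau(b)^{-1}\sigma(b)\quad\forall (a,b)\in N.$$ Then $$\widetilde G_1:=\{(a,e_2,\alpha_a,\lambda_a,\operatorname{Id}_{N_2}):a\in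 N_1\},\qquad \widetilde G_2:=\{(e_1,b,e_1,\sigma(b)^{-1}\tau(b),\lambda_b):b\in N_2\}$$ are subgroups of $\operatorname{Hol}(N)$ such that $\widetilde G_2$ normalizes $\widetilde G_1$, and $G:=\widetilde G_1\rtimes\widetilde G_2$ is a regular subgroup of $\operatorname{Hol}(N)$. Moreover, any skew brace $B$ of size $mn$ such that the normal subgroup of order $m$ of $(B,\cdot)$ is abelian is obtained in this way: there exist a semidirect product $N=N_1\rtimes_\sigma N_2$ with $|N_1|=m$, $N_1$ abelian and $|N_2|=n$, skew braces $B_1$ and $B_2$ with additive groups $N_1$ and $N_2$ respectively (with corresponding regular subgroups $\{(a,\lambda_a):a\in N_1\}$ and $\{(b,\lambda_b):b\in N_2\}$), a group morphism $\tau:(B_2,\circ)\to\operatorname{Aut}(B_1,\cdot)$ and a map $\alpha:N_1\to N_1$, $a\mapsto\alpha_a$, satisfying $$\sigma(b)\lambda_a=\lambda_a\sigma(b)\quad\forall a\in N_1,\ b\in N_2,$$ $$\sigma(b\,\lambda_b(c)\,b^{-1})=\tau(b)\sigma(c)\tau(b)^{-1}\quad\forall b,c\in N_2,$$ $$\alpha_{a\circ a'}=\alpha_a\lambda_a(\alpha_{a'})\quad\forall a,a'\in N_1,$$ $$\alpha_{A_b}=\sigma(b)^{-1}\tau(b)(\alpha_a),\qquad \lambda_{A_b}=\sigma(b)^{-1}\tau(b)\lambda_a\tau(b)^{-1}\sigma(b)\quad\forall (a,b)\in N,$$ where $A_b=\tau(b)(a\alpha_a)\cdot\sigma(b)^{-1}\tau(b)(\alpha_a^{-1})$,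 such that $B$ is isomorphic to the skew brace corresponding to the regular subgroup $G=\widetilde G_1\rtimes\widetilde G_2$ of $\operatorname{Hol}(N)$, with $\widetilde G_1=\{(a,e_2,\alpha_a,\lambda_a,\operatorname{Id}_{N_2}):a\in N_1\}$ and $\widetilde G_2=\{(e_1,b,e_1,\sigma(b)^{-1}\tau(b),\lambda_b):b\in N_2\}$.
   Context: A skew (left) brace is a set $B$ with two operations $\cdot,\circ$ such that $(B,\cdot)$ (additive group) and $(B,\circ)$ (multiplicative group) are groups and $a\circ(b\cdot c)=(a\circ b)\cdot a^{-1}\cdot(a\circ c)$ for all $a,b,c$, where $a^{-1}$ is the inverse in $(B,\cdot)$. For $a\in B$, $\lambda_a(b)=a^{-1}\cdot(a\circ b)$; this is an automorphism of $(B,\cdot)$. An isomorphism of skew braces is a bijection preserving both operations. For a group $N$, $\operatorname{Hol}(N)=N\rtimes\operatorname{Aut}N$ with product $(x,\varphi)(x',\varphi')=(x\varphi(x'),\varphi\varphi')$, acting on $N$ by $(x,\varphi)\cdot y=x\varphi(y)$; a subgroup $G$ is regular if this action of $G$ on $N$ is simply transitive, and then the projection $G\to N$ on the first component is bijective. A skew brace $(B,\cdot,\circ)$ corresponds to the regular subgroup $\{(a,\lambda_a):a\in B\}$ of $\operatorname{Hol}(B,\cdot)$; conversely a regular subgroup $G\le\operatorname{Hol}(N)$ corresponds to the skew brace with additive group $N$ and $a\circ b=a\cdot f(b)$, where $(a,f)$ is the unique element of $G$ with first component $a$. Notation for $N=N_1\rtimes_\sigma N_2$: the product is $(x_1,x_2)(y_1,y_2)=(x_1\sigma(x_2)(y_1),x_2y_2)$;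 $e_i$ is the identity of $N_i$. For $\varphi_1\in\operatorname{Aut}N_1$ and $\varphi_2\in\operatorname{Aut}N_2$ with $\sigma(\varphi_2(x))=\varphi_1\sigma(x)\varphi_1^{-1}$ for all $x\in N_2$, the map $(\varphi_1,\varphi_2):(x_1,x_2)\mapsto(\varphi_1(x_1),\varphi_2(x_2))$ is an automorphism of $N$. For $\alpha\in N_1$, the triple $(\alpha,\varphi_1,\varphi_2)$ denotes the automorphism $\operatorname{conj}_\alpha\circ(\varphi_1,\varphi_2)$ of $N$, where $\operatorname{conj}_\alpha$ is conjugation $x\mapsto\alpha x\alpha^{-1}$ by $\alpha$. The quintuple $(a,b,\alpha,f,g)$ denotes the element $(x,\varphi)\in\operatorname{Hol}(N)$ with $x=(a,b)\in N$ and $\varphi=(\alpha,f,g)\in\operatorname{Aut}N$. Compositions of automorphisms are written as products. *)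

(* Defs.v *)
From HB Require Import structures.
From mathcomp Require Import all_boot all_fingroup.

Set Implicit Arguments.
Unset Strict Implicit.
Unset Printing Implicit Defensive.

Import GroupScope.

(* The group Aut N, with product f * g = f \o g: the opposite of the product  *)
(* of {perm N}, for which (f * g) x = g (f x).                                *)
Section AutType.
Variable N : finGroupType.

Record autType := AutType {
  autval :> {perm N};
  autvalP : autval \in Aut [set: N]
}.

HB.instance Definition _ := [isSub for autval].
HB.instance Definition _ := [Finite of autType by <:].

Definition aut_one := AutType (group1 (Aut_group [set: N])).
Definition aut_mul (f g : autType) := AutType (groupM (autvalP g) (autvalP f)).
Definition aut_inv (f : autType) := AutType (groupVr (autvalP f)).

Lemma aut_mulA : associative aut_mul.
Proof. by move=> f g h; apply: val_inj; rewrite /= mulgA. Qed.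
Lemma aut_mul1 : left_id aut_one aut_mul.
Proof. by move=> f; apply: val_inj; rewrite /= mulg1. Qed.
Lemma aut_mulV : left_inverse aut_one aut_inv aut_mul.
Proof. by move=> f; apply: val_inj; rewrite /= mulgV. Qed.

HB.instance Definition _ :=
  Finite_isGroup.Build autType aut_mulA aut_mul1 aut_mulV.

Lemma autE1 x : (1 : autType) x = x.
Proof. exact: perm1. Qed.
Lemma autEM (f g : autType) x : (f * g) x = f (g x).
Proof. exact: permM. Qed.
Lemma autK (f : autType) : cancel f f^-1.
Proof. exact: permK. Qed.
Lemma autKV (f : autType) : cancel f^-1 f.
Proof. exact: permKV. Qed.
Lemma autM (f : autType) : {morph f : x y / x * y}.
Proof.
by move=> x y; have /setIdP[_ /morphicP] := autvalP f; apply; rewrite inE.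
Qed.
Lemma aut1 (f : autType) : f 1 = 1.
Proof. by apply: (mulgI (f 1)); rewrite -autM !mulg1. Qed.
Lemma autP (f g : autType) : f =1 g -> f = g.
Proof. by move=> fg; apply: val_inj; apply/permP. Qed.

Lemma mk_autP (f : N -> N) (f_inj : injective f)
  (fM : {morph f : x y / x * y}) : perm f_inj \in Aut [set: N].
Proof.
rewrite inE; apply/andP; split; first by apply/subsetP=> x _; rewrite inE.
by apply/morphicP=> x y _ _; rewrite !permE fM.
Qed.
Definition mk_aut f f_inj fM := AutType (@mk_autP f f_inj fM).
Lemma mk_autE f f_inj fM x : @mk_aut f f_inj fM x = f x.
Proof. exact: permE. Qed.

Lemma conj_inj (x : N) : injective (fun y => x * y * x^-1).
Proof. by move=> y z /mulIg/mulgI. Qed.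
Lemma conj_morph (x : N) : {morph (fun y => x * y * x^-1) : y z / y * z}.
Proof. by move=> y z /=; rewrite !mulgA mulgKV. Qed.
Definition inner_aut (x : N) : autType := mk_aut (@conj_inj x) (conj_morph x).

End AutType.

(* The external semidirect product N1 ><|_sigma N2, with                      *)
(* (x1, x2) (y1, y2) = (x1 sigma(x2)(y1), x2 y2).                             *)
Section Sdp.
Variables (N1 N2 : finGroupType).

Record sdp (sigma : {morphism [set: N2] >-> autType N1}) :=
  SdpPair { sd1 : N1; sd2 : N2 }.

Variable sigma : {morphism [set: N2] >-> autType N1}.

Definition sdp_val (x : sdp sigma) := (sd1 x, sd2 x).
Definition sdp_of (x : N1 * N2) : sdp sigma := SdpPair sigma x.1 x.2.
Lemma sdp_valK : cancel sdp_val sdp_of. Proof. by case. Qed.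

HB.instance Definition _ := Finite.copy (sdp sigma) (can_type sdp_valK).

Definition sdp_one := SdpPair sigma 1 1.
Definition sdp_mul (x y : sdp sigma) :=
  SdpPair sigma (sd1 x * sigma (sd2 x) (sd1 y)) (sd2 x * sd2 y).
Definition sdp_inv (x : sdp sigma) :=
  SdpPair sigma ((sigma (sd2 x)^-1) (sd1 x)^-1) (sd2 x)^-1.

Lemma sdp_mulA : associative sdp_mul.
Proof.
move=> [x1 x2] [y1 y2] [z1 z2]; rewrite /sdp_mul /=; congr SdpPair.
  by rewrite morphM ?inE // autEM autM mulgA.
by rewrite mulgA.
Qed.
Lemma sdp_mul1 : left_id sdp_one sdp_mul.
Proof. by case=> x1 x2; rewrite /sdp_mul /= morph1 autE1 !mul1g. Qed.
Lemma sdp_mulV : left_inverse sdp_one sdp_inv sdp_mul.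
Proof.
by case=> x1 x2; rewrite /sdp_mul /sdp_inv /= -autM !mulVg aut1.
Qed.

HB.instance Definition _ :=
  Finite_isGroup.Build (sdp sigma) sdp_mulA sdp_mul1 sdp_mulV.

Definition sdp_compat (f : autType N1) (g : autType N2) :=
  forall x, sigma (g x) = f * sigma x * f^-1.

Section PairAut.
Variables (f : autType N1) (g : autType N2) (fg : sdp_compat f g).
Definition pair_fun (x : sdp sigma) := SdpPair sigma (f (sd1 x)) (g (sd2 x)).
Lemma pair_fun_inj : injective pair_fun.
Proof. by move=> [x1 x2] [y1 y2] [/perm_inj-> /perm_inj->]. Qed.
Lemma pair_fun_morph : {morph pair_fun : x y / x * y}.
Proof.
move=> [x1 x2] [y1 y2]; rewrite /pair_fun /= autM /=.
congr SdpPair; last by rewrite autM.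
by rewrite fg !autEM autK.
Qed.
Definition pair_aut : autType (sdp sigma) := mk_aut pair_fun_inj pair_fun_morph.
End PairAut.

(* The automorphism denoted by the triple (alpha, f, g). *)
Definition triple_aut (alpha : N1) f g (fg : sdp_compat f g) :
    autType (sdp sigma) :=
  inner_aut (SdpPair sigma alpha 1) * pair_aut fg.

End Sdp.

Definition hol (N : finGroupType) := sdp (idm_morphism [set: autType N]).
HB.instance Definition _ N := FinGroup.on (hol N).

Definition Hol (N : finGroupType) (x : N) (phi : autType N) : hol N :=
  SdpPair (idm_morphism [set: autType N]) x phi.

Definition hol_act (N : finGroupType) (g : hol N) (y : N) : N :=
  sd1 g * sd2 g y.

Definition regular_subgroup (N : finGroupType) (G : {set hol N}) : Prop :=
  group_set G /\ forall y z : N, exists! g, g \in G /\ hol_act g y = z.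

(* The element of Hol(N1 ><|_sigma N2) denoted by (a, b, alpha, f, g). *)
Definition quint (N1 N2 : finGroupType)
    (sigma : {morphism [set: N2] >-> autType N1}) (a : N1) (b : N2) (alpha : N1)
    (f : autType N1) (g : autType N2) (fg : sdp_compat sigma f g) :
    hol (sdp sigma) :=
  Hol (SdpPair sigma a b) (triple_aut alpha fg).
Arguments quint {N1 N2} sigma a b alpha f g fg.

(* Skew braces with additive group N, which is written multiplicatively. *)
Record skew_brace (N : finGroupType) := SkewBrace {
  circ : N -> N -> N;
  circ_unit : N;
  circ_inv : N -> N;
  circA : associative circ;
  circ1x : left_id circ_unit circ;
  circx1 : right_id circ_unit circ;
  circVx : left_inverse circ_unit circ_inv circ;
  circxV : right_inverse circ_unit circ_inv circ;
  circ_mul : forall a b c, circ a (b * c) = circ a b * a^-1 * circ a c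
}.

(* The multiplicative group (B, \o). *)
Definition circ_group (N : finGroupType) (B : skew_brace N) : Type := N.
HB.instance Definition _ N (B : skew_brace N) := Finite.copy (circ_group B) N.
HB.instance Definition _ N (B : skew_brace N) :=
  Finite_isGroup.Build (circ_group B) (circA B) (circ1x B) (circVx B).

Section Lambda.
Variables (N : finGroupType) (B : skew_brace N) (a : N).
Definition lambda_fun (b : N) := a^-1 * circ B a b.
Lemma lambda_inj : injective lambda_fun.
Proof.
move=> b c /mulgI eq_bc.
by rewrite -[b](circ1x B) -[c](circ1x B) -(circVx B a) -!circA eq_bc.
Qed.
Lemma lambda_morph : {morph lambda_fun : b c / b * c}.
Proof. by move=> b c; rewrite /lambda_fun circ_mul !mulgA. Qed.
Definition lambda : autType N := mk_aut lambda_inj lambda_morph.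
End Lambda.

Definition skew_brace_iso (N N' : finGroupType)
    (B : skew_brace N) (B' : skew_brace N') : Prop :=
  exists h : N -> N', [/\ bijective h, {morph h : a b / a * b}
    & {morph h : a b / circ B a b >-> circ B' a b}].

(* The skew brace of a regular subgroup G of Hol(N): a \o b = a f(b), where   *)
(* (a, f) is the element of G with first component a.                         *)
Section BraceOfRegular.
Variables (N : finGroupType) (G : {set hol N}) (regG : regular_subgroup G).

Lemma regular_ex (a : N) : exists g : hol N, (g \in G) && (sd1 g == a).
Proof.
have [_ /(_ 1 a)[g [[Gg ga] _]]] := regG; exists g.
by rewrite Gg -ga /hol_act aut1 mulg1 eqxx.
Qed.
Definition reg_elt (a : N) : hol N := xchoose (regular_ex a).

Lemma reg_elt_in a : reg_elt a \in G.
Proof. by case/andP: (xchooseP (regular_ex a)). Qed.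
Lemma reg_elt1 a : sd1 (reg_elt a) = a.
Proof. by case/andP: (xchooseP (regular_ex a)) => _ /eqP. Qed.
Lemma reg_elt_uniq g : g \in G -> reg_elt (sd1 g) = g.
Proof.
move=> Gg; have [_ /(_ 1 (sd1 g))[h [_ hP]]] := regG.
have <- : h = reg_elt (sd1 g).
  by apply: hP; rewrite reg_elt_in /hol_act aut1 mulg1 reg_elt1.
by apply: hP; rewrite /hol_act aut1 mulg1.
Qed.

Definition reg_circ (a b : N) : N := a * sd2 (reg_elt a) b.
Definition reg_inv (a : N) : N := sd1 (reg_elt a)^-1.

Lemma reg_eltM a b : reg_elt (reg_circ a b) = reg_elt a * reg_elt b.
Proof.
have [gG _] := regG; pose H := group gG.
rewrite -(@reg_elt_uniq (reg_elt a * reg_elt b)) /=; last first.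
  by apply: (@groupM _ H); apply: reg_elt_in.
by rewrite /idm !reg_elt1.
Qed.
Lemma reg_elt_1 : reg_elt 1 = 1.
Proof.
have [gG _] := regG; rewrite -(@reg_elt_uniq 1) //.
exact: (group1 (group gG)).
Qed.
Lemma reg_eltV a : reg_elt (reg_inv a) = (reg_elt a)^-1.
Proof.
have [gG _] := regG; rewrite reg_elt_uniq //.
by apply: (@groupVr _ (group gG)); apply: reg_elt_in.
Qed.
Lemma reg_elt_inj : injective reg_elt.
Proof. by move=> a b ab; rewrite -(reg_elt1 a) ab reg_elt1. Qed.

Lemma reg_circA : associative reg_circ.
Proof. by move=> a b c; apply: reg_elt_inj; rewrite !reg_eltM mulgA. Qed.
Lemma reg_circ1x : left_id 1 reg_circ.
Proof. by move=> a; apply: reg_elt_inj; rewrite reg_eltM reg_elt_1 mul1g. Qed.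
Lemma reg_circx1 : right_id 1 reg_circ.
Proof. by move=> a; apply: reg_elt_inj; rewrite reg_eltM reg_elt_1 mulg1. Qed.
Lemma reg_circVx : left_inverse 1 reg_inv reg_circ.
Proof.
by move=> a; apply: reg_elt_inj; rewrite reg_eltM reg_eltV mulVg reg_elt_1.
Qed.
Lemma reg_circxV : right_inverse 1 reg_inv reg_circ.
Proof.
by move=> a; apply: reg_elt_inj; rewrite reg_eltM reg_eltV mulgV reg_elt_1.
Qed.
Lemma reg_circ_mul a b c :
  reg_circ a (b * c) = reg_circ a b * a^-1 * reg_circ a c.
Proof. by rewrite /reg_circ autM !mulgA mulgKV. Qed.

Definition brace_of_regular : skew_brace N :=
  SkewBrace reg_circA reg_circ1x reg_circx1 reg_circVx reg_circxV reg_circ_mul.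
End BraceOfRegular.

Section LiftData.
Variables (N1 N2 : finGroupType).
Variable sigma : {morphism [set: N2] >-> autType N1}.
Variables (B1 : skew_brace N1) (B2 : skew_brace N2).
Variable tau : {morphism [set: circ_group B2] >-> autType N1}.
Variable alpha : N1 -> N1.

Definition A_ (a : N1) (b : N2) : N1 :=
  tau b (a * alpha a) * ((sigma b)^-1 * tau b) (alpha a)^-1.

Record lift_conditions : Prop := LiftConditions {
  lift_sigma_lambda : forall (a : N1) (b : N2),
    sigma b * lambda B1 a = lambda B1 a * sigma b;
  lift_sigma_tau : forall b c : N2,
    sigma (b * lambda B2 b c * b^-1) = tau b * sigma c * (tau b)^-1;
  lift_alpha_circ : forall a a' : N1,
    alpha (circ B1 a a') = alpha a * lambda B1 a (alpha a');
  lift_alpha_A : forall (a : N1) (b : N2),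
    alpha (A_ a b) = ((sigma b)^-1 * tau b) (alpha a);
  lift_lambda_A : forall (a : N1) (b : N2),
    lambda B1 (A_ a b)
      = (sigma b)^-1 * tau b * lambda B1 a * (tau b)^-1 * sigma b
}.

Hypothesis H : lift_conditions.

Lemma compat1 a : sdp_compat sigma (lambda B1 a) 1.
Proof. by move=> x; rewrite autE1 -(lift_sigma_lambda H) mulgK. Qed.
Lemma compat2 b : sdp_compat sigma ((sigma b)^-1 * tau b) (lambda B2 b).
Proof.
move=> c; rewrite invMg invgK !mulgA -[_ * tau b * _ * _]mulgA.
rewrite -[_ * (sigma c * _)]mulgA [tau b * _]mulgA -(lift_sigma_tau H).
by rewrite !morphM ?morphV ?inE // !mulgA mulVg mul1g mulgKV.
Qed.

Definition G1_tilde : {set hol (sdp sigma)} :=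
  [set quint sigma a 1 (alpha a) (lambda B1 a) 1 (compat1 a) | a : N1].
Definition G2_tilde : {set hol (sdp sigma)} :=
  [set quint sigma 1 b 1 ((sigma b)^-1 * tau b) (lambda B2 b) (compat2 b)
     | b : N2].
End LiftData.

(* Main.v *)
Require Import Defs.
From HB Require Import structures.
From mathcomp Require Import all_boot all_fingroup.
From mathcomp Require Import pgroup nilpotent commutator hall finmodule.
Import GroupScope.

(** Every computation with elements of Hol(N) is done on the affine maps
    [hol_act g] that they induce. For the first half, the elements of the two
    families satisfy g2(b) g1(a) = g1(A_b) g2(b), and g2(b) g1(a) maps the
    identity to (tau(b)(a), b), so G = G2 G1 is transitive at the identity and
    only one element of G has a given first component.

    For the second half, the normal subgroup K of order m is a normal Hall
    subgroup both of (B, .) and of (B, o). Let Hc be a complement of K in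
    (B, o). In the subgroup of Hol(B, .) generated by the translations and by
    lambda(Hc), K is a normal Hall subgroup, and Schur-Zassenhaus conjugacy
    puts lambda(Hc) and a K-conjugate of {(b, lambda_b) : b in Hc} in the same
    complement of K. It follows that some o-conjugate H of Hc is also a
    subgroup of (B, .). Then B = K H for both operations, sigma is conjugation
    by H, and tau(b) is lambda_b followed by conjugation by b. For a in K,
    lambda_a maps H to another complement of K, so it is conjugation by some
    element of K on H; as K = [K, H] x C_K(H), this element is unique if it is
    taken in [K, H], and uniqueness yields all the identities satisfied by
    alpha. *)

(** * Skew braces and the affine action of the holomorph *)

Lemma autV {N : finGroupType} (f : autType N) x : f x^-1 = (f x)^-1.
Proof. by apply: (mulgI (f x)); rewrite -autM !mulgV aut1. Qed.

Lemma abelian_mulgC {N : finGroupType} (abN : abelian [set: N]) :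
  forall x y : N, x * y = y * x.
Proof. by move=> x y; apply: (centsP abN); rewrite inE. Qed.

Lemma circ_lambda {N : finGroupType} (B : skew_brace N) a b :
  circ B a b = a * lambda B a b.
Proof. by rewrite mk_autE /lambda_fun mulKVg. Qed.

Lemma circ_unit1 {N : finGroupType} (B : skew_brace N) : circ_unit B = 1.
Proof.
by have := circ1x B 1; rewrite circ_lambda aut1 mulg1.
Qed.

Lemma circr1 {N : finGroupType} (B : skew_brace N) a : circ B a 1 = a.
Proof. by rewrite circ_lambda aut1 mulg1. Qed.

Lemma lambdaM {N : finGroupType} (B : skew_brace N) a b :
  lambda B (circ B a b) = lambda B a * lambda B b.
Proof.
apply: autP => x; apply: (mulgI (circ B a b)).
by rewrite autEM -circ_lambda -circA !circ_lambda autM mulgA.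
Qed.

Lemma lambda1 {N : finGroupType} (B : skew_brace N) : lambda B 1 = 1.
Proof.
apply: autP => x; rewrite autE1 mk_autE /lambda_fun invg1 mul1g.
by rewrite -[1](circ_unit1 B) circ1x.
Qed.

Lemma hol_actM {N : finGroupType} (g h : hol N) y :
  hol_act (g * h) y = hol_act g (hol_act h y).
Proof. by case: g h => [x f] [x' f']; rewrite /hol_act /= autEM autM mulgA. Qed.

Lemma hol_act1 {N : finGroupType} (g : hol N) : hol_act g 1 = sd1 g.
Proof. by rewrite /hol_act aut1 mulg1. Qed.

Lemma hol_act_inj {N : finGroupType} (g h : hol N) :
  hol_act g =1 hol_act h -> g = h.
Proof.
move=> gh; have e : sd1 g = sd1 h by rewrite -!hol_act1.
case: g h e gh => [x f] [y g] /= <- gh; congr SdpPair.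
by apply: autP => z; apply: (mulgI x); apply: gh.
Qed.

Lemma sdp_mulE {N1 N2 : finGroupType}
    (sigma : {morphism [set: N2] >-> autType N1}) x1 x2 y1 y2 :
  SdpPair sigma x1 x2 * SdpPair sigma y1 y2
    = SdpPair sigma (x1 * sigma x2 y1) (x2 * y2).
Proof. by []. Qed.

Lemma triple_autE {N1 N2 : finGroupType}
    {sigma : {morphism [set: N2] >-> autType N1}} (alpha : N1) f g
    (fg : sdp_compat sigma f g) y1 y2 :
  triple_aut alpha fg (SdpPair sigma y1 y2)
    = SdpPair sigma (alpha * f y1 * sigma (g y2) alpha^-1) (g y2).
Proof.
rewrite autEM !mk_autE /pair_fun /=.
have -> : (SdpPair sigma alpha 1)^-1 = SdpPair sigma alpha^-1 1.
  by congr SdpPair; rewrite /= ?invg1 // morph1 autE1.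
by rewrite !sdp_mulE morph1 autE1 mul1g mulg1.
Qed.

(** If [gy] sends 1 to y, then g sends y to z exactly when g * gy sends 1 to z. So simple
    transitivity only has to be checked at 1, whose image under g is [sd1 g]. *)
Lemma regular_at1 {N : finGroupType} (G : {set hol N}) :
    group_set G -> (forall z, exists2 g, g \in G & sd1 g = z) ->
    {in G &, injective (@sd1 _ _ _)} -> regular_subgroup G.
Proof.
move=> gG surj inj; split=> // y z; pose H := group gG.
have [gy Gy sy] := surj y; have [gz Gz sz] := surj z.
have Ky : hol_act gy^-1 y = 1.
  by rewrite -{1}sy -hol_act1 -hol_actM mulVg hol_act1.
exists (gz * gy^-1); split.
  split; first by apply: (@groupM _ H) => //; apply: (@groupVr _ H).
  by rewrite hol_actM Ky hol_act1.
move=> g [Gg gyz]; apply: (mulIg gy); rewrite mulgKV; apply: inj => //.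
  exact: (@groupM _ H).
by rewrite -[RHS]hol_act1 hol_actM hol_act1 sy gyz.
Qed.

(** * The regular subgroup built from lifting data *)

Section RegularLift.
Variables (N1 N2 : finGroupType) (abel_N1 : abelian [set: N1]).
Variable sigma : {morphism [set: N2] >-> autType N1}.
Variables (B1 : skew_brace N1) (B2 : skew_brace N2).
Variable tau : {morphism [set: circ_group B2] >-> autType N1}.
Variables (alpha : N1 -> N1) (H : lift_conditions sigma B1 tau alpha).

Definition lift1 a := quint sigma a 1 (alpha a) (lambda B1 a) 1 (compat1 H a).
Definition lift2 b :=
  quint sigma 1 b 1 ((sigma b)^-1 * tau b) (lambda B2 b) (compat2 H b).
Let C : forall x y : N1, x * y = y * x := abelian_mulgC abel_N1.

Lemma act_lift1 a y1 y2 :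
  hol_act (lift1 a) (SdpPair sigma y1 y2)
    = SdpPair sigma (a * alpha a * lambda B1 a y1 * sigma y2 (alpha a)^-1) y2.
Proof.
have -> : hol_act (lift1 a) (SdpPair sigma y1 y2) = SdpPair sigma a 1 *
  triple_aut (alpha a) (compat1 H a) (SdpPair sigma y1 y2) by [].
by rewrite triple_autE sdp_mulE autE1 morph1 autE1 mul1g !mulgA.
Qed.

Lemma act_lift2 b y1 y2 :
  hol_act (lift2 b) (SdpPair sigma y1 y2)
    = SdpPair sigma (tau b y1) (circ B2 b y2).
Proof.
have -> : hol_act (lift2 b) (SdpPair sigma y1 y2) = SdpPair sigma 1 b *
  triple_aut 1 (compat2 H b) (SdpPair sigma y1 y2) by [].
rewrite triple_autE sdp_mulE invg1 aut1 mulg1 !mul1g circ_lambda.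
by rewrite -autEM mulgA mulgV mul1g.
Qed.

Lemma lift1M a a' : lift1 a * lift1 a' = lift1 (circ B1 a a').
Proof.
apply: hol_act_inj => -[y1 y2]; rewrite hol_actM !act_lift1; congr SdpPair.
rewrite (lift_alpha_circ H) lambdaM autEM !autM invMg autM circ_lambda.
rewrite -[lambda B1 a (sigma y2 _)]autEM -(lift_sigma_lambda H) autEM.
(* What remains is to exchange [alpha a] and lambda_a(a'), which commute because [N1] is abelian. *)
by rewrite autV !mulgA -(mulgA a) [alpha a * _]C mulgA.
Qed.

Lemma lift2M b b' : lift2 b * lift2 b' = lift2 (circ B2 b b').
Proof.
apply: hol_act_inj => -[y1 y2]; rewrite hol_actM !act_lift2 circA.
by congr SdpPair; rewrite -autEM -morphM ?inE.
Qed.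

Lemma lift21 b a : lift2 b * lift1 a = lift1 (A_ sigma tau alpha a b) * lift2 b.
Proof.
apply: hol_act_inj => -[y1 y2].
rewrite !hol_actM !(act_lift1, act_lift2) (lift_alpha_A H); congr SdpPair.
set s := ((sigma b)^-1 * tau b) (alpha a).
(* A_b is designed for this: A_b alpha_{A_b} must be the leading factor tau(b)(a alpha_a) of the
   other side. *)
have -> : A_ sigma tau alpha a b * s = tau b (a * alpha a).
  by rewrite /A_ autV mulgKV.
have -> : lambda B1 (A_ sigma tau alpha a b) = tau b * lambda B1 a * (tau b)^-1.
  rewrite -[LHS](mulgK (sigma b)) -(lift_sigma_lambda H) (lift_lambda_A H).
  by rewrite !mulgA mulgV mul1g mulgK.
have -> : sigma (circ B2 b y2) = tau b * sigma y2 * (tau b)^-1 * sigma b.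
  by rewrite -(lift_sigma_tau H) -morphM ?inE // mulgKV -circ_lambda.
have -> : s^-1 = ((sigma b)^-1 * tau b) (alpha a)^-1 by rewrite autV.
by rewrite !autM !autEM autKV !autK.
Qed.

Lemma lift1_1 : lift1 1 = 1.
Proof. by apply: (mulgI (lift1 1)); rewrite lift1M circr1 mulg1. Qed.

Lemma lift2_1 : lift2 1 = 1.
Proof. by apply: (mulgI (lift2 1)); rewrite lift2M circr1 mulg1. Qed.

Lemma G1_group_set : group_set (G1_tilde H).
Proof.
apply/group_setP; split.
  by apply/imsetP; exists 1; rewrite // -/(lift1 1) lift1_1.
move=> _ _ /imsetP[a _ ->] /imsetP[a' _ ->].
by apply/imsetP; exists (circ B1 a a') => //; apply: lift1M.
Qed.

Lemma G2_group_set : group_set (G2_tilde H).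
Proof.
apply/group_setP; split.
  by apply/imsetP; exists 1; rewrite // -/(lift2 1) lift2_1.
move=> _ _ /imsetP[a _ ->] /imsetP[a' _ ->].
by apply/imsetP; exists (circ B2 a a') => //; apply: lift2M.
Qed.

Lemma G2_norm_G1 : G2_tilde H \subset 'N(G1_tilde H).
Proof.
(* As x ^ g is g^-1 x g, passing to the inverse of [lift2 b] gives the conjugation that [lift21]
   computes. *)
apply/subsetP=> _ /imsetP[b _ ->]; rewrite -groupV inE -/(lift2 b).
apply/subsetP=> _ /imsetP[_ /imsetP[a _ ->] ->].
apply/imsetP; exists (A_ sigma tau alpha a b) => //.
by rewrite conjgE invgK mulgA; apply: (canLR (mulgK _)); apply: lift21.
Qed.

(** This is why the factors are taken in this order: (a, b) is visibly recovered from the result,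
    whereas the opposite order gives a alpha_a sigma(b)(alpha_a)^-1 in the first coordinate. *)
Lemma sd1_lift21 b a : sd1 (lift2 b * lift1 a) = SdpPair sigma (tau b a) b.
Proof. by rewrite -hol_act1 hol_actM hol_act1 act_lift2 circr1. Qed.

(** The operation [><|] on sets is partial, with the empty set as default; normalization and trivial
    intersection make it the product set here. *)
Lemma G1_sdprod_G2 : G1_tilde H ><| G2_tilde H = G1_tilde H * G2_tilde H.
Proof.
apply: (@sdprodE _ (group G1_group_set) (group G2_group_set)).
  exact: G2_norm_G1.
apply/trivgP/subsetP=> _ /setIP[/imsetP[a _ ->]].
case/imsetP=> b _ /(congr1 (@sd1 _ _ _)).
by rewrite -/(lift1 a) inE => -[-> _]; rewrite lift1_1.
Qed.

Lemma G1_sdprod_G2P g :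
  reflect (exists b a, g = lift2 b * lift1 a) (g \in G1_tilde H ><| G2_tilde H).
Proof.
have -> : G1_tilde H ><| G2_tilde H = G2_tilde H * G1_tilde H.
  rewrite G1_sdprod_G2; symmetry.
  exact: (@normC _ _ (group G1_group_set) G2_norm_G1).
apply: (iffP mulsgP) => [[_ _ /imsetP[b _ ->] /imsetP[a _ ->] ->]|[b [a ->]]].
  by exists b, a.
by exists (lift2 b) (lift1 a) => //; apply: imset_f.
Qed.

Lemma lift_regular : regular_subgroup (G1_tilde H ><| G2_tilde H).
Proof.
apply: regular_at1.
- rewrite G1_sdprod_G2.
  have := G2_norm_G1; rewrite -[G1_tilde H]/(gval (group G1_group_set)).
  rewrite -[G2_tilde H]/(gval (group G2_group_set)) => /normC cG.
  exact/comm_group_setP.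
- move=> [z1 z2]; exists (lift2 z2 * lift1 ((tau z2)^-1 z1)).
    by apply/G1_sdprod_G2P; exists z2, ((tau z2)^-1 z1).
  by rewrite sd1_lift21 autKV.
- move=> _ _ /G1_sdprod_G2P[b [a ->]] /G1_sdprod_G2P[b' [a' ->]].
  by rewrite !sd1_lift21 => -[+ eb]; rewrite eb => /perm_inj->.
Qed.
End RegularLift.
Arguments lift1 {N1 N2 sigma B1 B2 tau alpha}.
Arguments lift2 {N1 N2 sigma B1 B2 tau alpha}.
Arguments act_lift1 {N1 N2 sigma B1 B2 tau alpha}.
Arguments act_lift2 {N1 N2 sigma B1 B2 tau alpha}.
Arguments G1_sdprod_G2P {N1 N2} abel_N1 {sigma B1 B2 tau alpha H g}.
Arguments lift_regular {N1 N2} abel_N1 {sigma B1 B2 tau alpha} H.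

(** * Restriction of automorphisms and skew braces to a subgroup *)

Lemma inner_autE {N : finGroupType} (x y : N) : inner_aut x y = x * y * x^-1.
Proof. exact: mk_autE. Qed.

Lemma sgM {N : finGroupType} {K : {group N}} (x y : subg_of K) :
  sgval (x * y) = sgval x * sgval y.
Proof. by []. Qed.

Lemma sgV {N : finGroupType} {K : {group N}} (x : subg_of K) :
  sgval x^-1 = (sgval x)^-1.
Proof. by []. Qed.

Section AutSub.
Variables (N : finGroupType) (K : {group N}) (f : autType N).
Hypothesis fK : forall x, x \in K -> f x \in K.

Let fs (x : subg_of K) : subg_of K := subg K (f (sgval x)).
Let fsE x : sgval (fs x) = f (sgval x).
Proof. by rewrite subgK // fK // subgP. Qed.
Let fs_inj : injective fs.
Proof. by move=> x y /(congr1 sgval); rewrite !fsE => /perm_inj/val_inj. Qed.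
Let fs_morph : {morph fs : x y / x * y}.
Proof. by move=> x y; apply: val_inj; rewrite /= !fsE -autM. Qed.

Definition aut_sub : autType (subg_of K) := mk_aut fs_inj fs_morph.
Lemma aut_subE x : sgval (aut_sub x) = f (sgval x).
Proof. by rewrite mk_autE fsE. Qed.
End AutSub.
Arguments aut_sub {N K f}.
Arguments aut_subE {N K f}.

Lemma lambda_circ_inv {N : finGroupType} (B : skew_brace N) a :
  lambda B (circ_inv B a) = (lambda B a)^-1.
Proof.
apply: (mulIg (lambda B a)).
by rewrite -lambdaM circVx circ_unit1 lambda1 mulVg.
Qed.

Lemma circ_invE {N : finGroupType} (B : skew_brace N) a :
  circ_inv B a = (lambda B a)^-1 a^-1.
Proof.
apply: (canRL (autK _)); apply: (mulgI a).
by rewrite -circ_lambda circxV mulgV circ_unit1.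
Qed.

(** By finiteness, the injective map f sends K onto K. *)
Lemma aut_stable_inv {N : finGroupType} (K : {group N}) (f : autType N) :
  (forall x, x \in K -> f x \in K) -> forall x, x \in K -> f^-1 x \in K.
Proof.
move=> fK x Kx; have : x \in f @: K.
  have/eqP-> // : f @: K == K.
  rewrite eqEcard card_imset ?leqnn ?andbT; last exact: perm_inj.
  by apply/subsetP=> _ /imsetP[y Ky ->]; apply: fK.
by case/imsetP=> y Ky ->; rewrite autK.
Qed.

Section SubBrace.
Variables (N : finGroupType) (B : skew_brace N) (K : {group N}).
Hypothesis lamK : forall a x, a \in K -> x \in K -> lambda B a x \in K.

Let sc (a b : subg_of K) : subg_of K := subg K (circ B (sgval a) (sgval b)).
Let si (a : subg_of K) : subg_of K := subg K (circ_inv B (sgval a)).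

Let scE a b : sgval (sc a b) = circ B (sgval a) (sgval b).
Proof. by rewrite subgK // circ_lambda groupM ?subgP // lamK ?subgP. Qed.
Let siE a : sgval (si a) = circ_inv B (sgval a).
Proof.
rewrite subgK // circ_invE aut_stable_inv ?groupV ?subgP // => x.
by apply: lamK; apply: subgP.
Qed.
Let scA : associative sc.
Proof. by move=> a b c; apply: val_inj; rewrite /= !scE circA. Qed.
Let sc1x : left_id 1 sc.
Proof.
by move=> a; apply: val_inj; rewrite /= scE /= -[1](circ_unit1 B) circ1x.
Qed.
Let scx1 : right_id 1 sc.
Proof. by move=> a; apply: val_inj; rewrite /= scE /= circr1. Qed.
Let scVx : left_inverse 1 si sc.
Proof.
by move=> a; apply: val_inj; rewrite /= scE siE circVx circ_unit1.
Qed.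
Let scxV : right_inverse 1 si sc.
Proof.
by move=> a; apply: val_inj; rewrite /= scE siE circxV circ_unit1.
Qed.
Let sc_mul a b c : sc a (b * c) = sc a b * a^-1 * sc a c.
Proof. by apply: val_inj; rewrite /= !scE /= circ_mul. Qed.

Definition sub_brace : skew_brace (subg_of K) :=
  SkewBrace scA sc1x scx1 scVx scxV sc_mul.

Lemma sub_circE a b :
  sgval (circ sub_brace a b) = circ B (sgval a) (sgval b).
Proof. exact: scE. Qed.

Lemma sub_lambdaE a b :
  sgval (lambda sub_brace a b) = lambda B (sgval a) (sgval b).
Proof. by rewrite !mk_autE /lambda_fun /= -sub_circE. Qed.
End SubBrace.
Arguments sub_brace {N B K}.

(** * Commutators and centralizers under coprime action *)

(** The hypotheses send each generator [x, y] to [f x, y']. They do not ask f to preserve H, so that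
    they cover lambda_a for a in K, which may move H, as well as for a in H. *)
Lemma commg_stable {N : finGroupType} (K H : {group N}) (f : autType N) :
    (forall x, x \in K -> f x \in K) ->
    (forall x y, x \in K -> y \in H ->
       exists2 y', y' \in H & f (x ^ y) = f x ^ y') ->
  forall x, x \in [~: K, H] -> f x \in [~: K, H].
Proof.
move=> fK fH.
have gP : group_set [set x | f x \in [~: K, H]].
  apply/group_setP; split=> [|x y]; first by rewrite inE aut1 group1.
  by rewrite !inE autM => *; apply: groupM.
suff /subsetP sP : [~: K, H] \subset group gP by move=> x /sP; rewrite inE.
rewrite gen_subG; apply/subsetP=> _ /imset2P[x y Kx Hy ->].
have [y' Hy' e] := fH x y Kx Hy.
by rewrite inE commgEl autM autV e -commgEl mem_commg ?fK.
Qed.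

(** A acts trivially on G / [G, A], and by coprimeness the fixed points of the quotient lift to
    C_G(A). *)
Lemma coprime_commg_cent {gT : finGroupType} (A G : {group gT}) :
    A \subset 'N(G) -> coprime #|G| #|A| -> solvable G ->
  G \subset [~: G, A] * 'C_G(A).
Proof.
move=> nGA coGA solG; rewrite -quotientSK ?commg_norml //.
rewrite coprime_quotient_cent ?commg_subl ?commg_normr //.
by rewrite subsetI subxx quotient_cents2r.
Qed.

(** * Lifting data read off a common complement H of K *)

Section Decomposition.
Variables (bT : finGroupType) (B : skew_brace bT) (K H : {group bT}).
Hypotheses (nK : K <| [set: bT]) (abK : abelian K).
Hypotheses (co : coprime #|K| #|H|) (KH : K * H = [set: bT]).
Hypothesis lamK : forall a x, x \in K -> lambda B a x \in K.
Hypothesis lamH : forall a x, a \in H -> x \in H -> lambda B a x \in H.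
Hypothesis nKc :
  forall a b, a \in K -> circ B (circ B b a) (circ_inv B b) \in K.

Let tiKH : K :&: H = 1 := coprime_TIg co.
Let nKx x : x \in 'N(K).
Proof. by apply: (subsetP (normal_norm nK)); rewrite inE. Qed.
Let conjK b x : x \in K -> b * x * b^-1 \in K.
Proof. by move=> Kx; rewrite -mulgA -{1}[b]invgK -conjgE memJ_norm. Qed.
Let Kc x y : x \in K -> y \in K -> x * y = y * x.
Proof. by move=> Kx Ky; apply: (centsP abK). Qed.

(** By normality of K in (B, o), a o y = y o k with k in K. Hence lambda_a(y) = a^-1 y lambda_y(k),
    which is y modulo K. *)
Lemma lambda_mod a y : a \in K -> lambda B a y * y^-1 \in K.
Proof.
move=> Ka; have := nKc _ (circ_inv B y) Ka.
set k := circ B _ _ => Kk.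
have e : circ B a y = circ B y k.
  rewrite /k.
  have -> : circ_inv B (circ_inv B y) = y.
    exact: (@invgK (circ_group B) y).
  by rewrite !circA circxV circ1x.
have -> : lambda B a y = a^-1 * (y * lambda B y k).
  by rewrite -circ_lambda -e circ_lambda mulKg.
by rewrite -!mulgA groupM ?groupV // mulgA conjK ?lamK.
Qed.

Lemma lambda_inner a : a \in K ->
  exists2 u, u \in [~: K, H] & {in H, forall y, lambda B a y = u * y * u^-1}.
Proof.
move=> Ka; have gL : group_set (lambda B a @: H).
  apply/group_setP; split; first by apply/imsetP; exists 1; rewrite ?aut1.
  move=> _ _ /imsetP[x Hx ->] /imsetP[y Hy ->].
  by rewrite -autM imset_f ?groupM.
have nKH : H \subset 'N(K) by apply/subsetP.
have sLKH : group gL \subset K * H by rewrite KH subsetT.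
have [x Kx /= eL] := SchurZassenhaus_trans_sol (abelian_sol abK) nKH sLKH co
  (card_imset _ (@perm_inj _ _)).
(* Conjugacy of the two subgroups only gives x^-1 y' x with some y' in H; reducing modulo K shows
   that y' y^-1 lies in K, which meets H trivially. *)
have e y : y \in H -> lambda B a y = x^-1 * y * x.
  move=> Hy; have : lambda B a y \in H :^ x by rewrite -eL imset_f.
  case/imsetP=> y' Hy'; rewrite conjgE mulgA => ey.
  suff /set1P e1 : y' * y^-1 \in [1] by rewrite ey -[y'](mulgKV y) e1 mul1g.
  rewrite -tiKH inE (groupM Hy') ?groupV // andbT.
  have := lambda_mod a y Ka; rewrite ey => Kl.
  have := groupM (groupM Kx Kl) (conjK y _ (groupVr Kx)).
  by rewrite !mulgA mulgV mul1g mulgKV mulgK.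
(* The factor of x^-1 in C_K(H) does not affect conjugation on H, so only the factor in [K, H] is
   kept. *)
have : x^-1 \in [~: K, H] * 'C_K(H).
  apply: (subsetP (coprime_commg_cent _ _ nKH co (abelian_sol abK))).
  by rewrite groupV.
case/mulsgP=> u c Ru /setIP[_ cH] ex; exists u => // y Hy.
rewrite e // ex -[x]invgK ex invMg -!mulgA; congr (_ * _).
by rewrite mulgA (centP cH y Hy) -mulgA mulKVg.
Qed.

(** The element v^-1 u centralizes H, and [K, H] meets C_K(H) trivially for a coprime action on an
    abelian group. *)
Lemma commg_inner_uniq u v : u \in [~: K, H] -> v \in [~: K, H] ->
  {in H, forall y, u * y * u^-1 = v * y * v^-1} -> u = v.
Proof.
move=> Ru Rv uv; have nKH : H \subset 'N(K) by apply/subsetP.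
apply/esym/eqP; rewrite eq_mulVg1; apply/eqP/set1P.
rewrite -[[set 1]](coprime_abel_cent_TI nKH co abK) inE groupM ?groupV //=.
apply/centP=> y Hy; apply: (mulgI v); apply: (mulIg u^-1).
by rewrite !mulgA mulgV mul1g -uv // mulgK.
Qed.

(** For a in K the default 1 is never reached, by [lambda_inner]. *)
Let alpha0 a : bT := odflt 1 [pick u in [~: K, H] |
  [forall y in H, lambda B a y == u * y * u^-1]].

Let alpha0P a : a \in K -> alpha0 a \in [~: K, H]
  /\ {in H, forall y, lambda B a y = alpha0 a * y * (alpha0 a)^-1}.
Proof.
rewrite /alpha0 => Ka; case: pickP => [u /andP[Ru /forall_inP Hu] | no] /=.
  by split=> // y /Hu/eqP.
have [u Ru Hu] := lambda_inner a Ka.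
have /negP[] := negbT (no u); rewrite Ru /=.
by apply/forall_inP=> y /Hu/eqP.
Qed.

Let alpha0_in a (Ka : a \in K) := proj1 (alpha0P a Ka).
Let alpha0E a (Ka : a \in K) := proj2 (alpha0P a Ka).

Let RK u : u \in [~: K, H] -> u \in K.
Proof. by apply: subsetP; rewrite commg_subl; apply/subsetP. Qed.

(** Applying lambda_a replaces conjugation by b with conjugation by u b u^-1, where u is in K and so
    acts trivially on the abelian group K. This yields the commutation of sigma(b) with lambda_a. *)
Lemma lambda_conj a k b : a \in K -> k \in K -> b \in H ->
  lambda B a (b * k * b^-1) = b * lambda B a k * b^-1.
Proof.
move=> Ka Kk Hb; rewrite !autM autV (alpha0E a Ka b Hb).
have Ku := RK _ (alpha0_in a Ka); set u := alpha0 a in Ku *.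
set k' := lambda B a k; have Kk' : k' \in K by apply: lamK.
have -> : u * b * u^-1 * k' * (u * b * u^-1)^-1
    = u * (b * (u^-1 * (k' * u)) * b^-1) * u^-1.
  by rewrite !invMg invgK !mulgA.
by rewrite (Kc k' u) // mulKg (Kc u) ?mulgK // conjK.
Qed.

Let lamRK a x : a \in K -> x \in [~: K, H] -> lambda B a x \in [~: K, H].
Proof.
move=> Ka; apply: commg_stable => [y|y z Ky Hz]; first exact: lamK.
exists z => //; have := lambda_conj a y z^-1 Ka Ky (groupVr Hz).
by rewrite invgK -!mulgA -!conjgE.
Qed.

Let lamRH a x : a \in H -> x \in [~: K, H] -> lambda B a x \in [~: K, H].
Proof.
move=> Ha; apply: commg_stable => [y|y z Ky Hz]; first exact: lamK.
by exists (lambda B a z); rewrite ?lamH // !conjgE !autM autV.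
Qed.

Let N1 : finGroupType := subg_of K.
Let N2 : finGroupType := subg_of H.

Let conjK' b x : x \in K -> inner_aut b x \in K.
Proof. by rewrite inner_autE; apply: conjK. Qed.
Let sig (b : N2) : autType N1 := aut_sub (conjK' (sgval b)).
Let sigE b x : sgval (sig b x) = sgval b * sgval x * (sgval b)^-1.
Proof. by rewrite aut_subE inner_autE. Qed.
Let sigM : {in [set: N2] &, {morph sig : b c / b * c}}.
Proof.
move=> b c _ _; apply: autP => x; apply: subg_inj.
by rewrite autEM !sigE sgM invMg !mulgA.
Qed.
Let sigma : {morphism [set: N2] >-> autType N1} := Morphism sigM.
Let sigmaE b x : sgval (sigma b x) = sgval b * sgval x * (sgval b)^-1.
Proof. exact: sigE. Qed.

Let B1 := sub_brace (fun a x (_ : a \in K) => lamK a x).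
Let B2 := sub_brace lamH.

Let tauK b x : x \in K -> (inner_aut b * lambda B b) x \in K.
Proof. by move=> Kx; rewrite autEM conjK' ?lamK. Qed.
(** With this choice b o (x y) = tau(b)(x) (b o y) for x in K and y in H, which is the action of
    [lift2 b]. *)
Let ta (b : circ_group B2) : autType N1 := aut_sub (tauK (sgval b)).
Let taE b x :
  sgval (ta b x) = sgval b * lambda B (sgval b) (sgval x) * (sgval b)^-1.
Proof. by rewrite aut_subE autEM inner_autE. Qed.
Let taM : {in [set: circ_group B2] &, {morph ta : b c / b * c}}.
Proof.
move=> b c _ _; apply: autP => x; apply: subg_inj.
rewrite autEM !taE.
have -> : sgval (b * c) = circ B (sgval b) (sgval c) by apply: sub_circE.
by rewrite lambdaM autEM circ_lambda !autM autV invMg !mulgA.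
Qed.
Let tau : {morphism [set: circ_group B2] >-> autType N1} := Morphism taM.
Let tauE b x :
  sgval (tau b x) = sgval b * lambda B (sgval b) (sgval x) * (sgval b)^-1.
Proof. exact: taE. Qed.

Let alpha (a : N1) : N1 := subg K (alpha0 (sgval a)).
Let alphaE a : sgval (alpha a) = alpha0 (sgval a).
Proof. by rewrite subgK // RK // alpha0_in // subgP. Qed.

Let stE (b : N2) x :
  sgval (((sigma b)^-1 * tau b) x) = lambda B (sgval b) (sgval x).
Proof.
apply: (mulgI (sgval b)); apply: (mulIg (sgval b)^-1).
by rewrite -sigmaE -tauE autEM autKV.
Qed.

Let conj_circ (b : N2) (a : N1) :=
  circ B (circ B (sgval b) (sgval a)) (circ_inv B (sgval b)).

Let lam_conj b a : lambda B (conj_circ b a)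
  = lambda B (sgval b) * lambda B (sgval a) * (lambda B (sgval b))^-1.
Proof. by rewrite !lambdaM lambda_circ_inv. Qed.

(** As lambda_b^-1 preserves H, the map lambda_b lambda_a lambda_b^-1 is on H conjugation by
    lambda_b(alpha_a); uniqueness in [K, H] concludes. *)
Let alpha_conj b a :
  alpha0 (conj_circ b a) = lambda B (sgval b) (alpha0 (sgval a)).
Proof.
have Kc' : conj_circ b a \in K by apply: nKc; apply: subgP.
have [Ka Hb] := (subgP a, subgP b).
apply: commg_inner_uniq => [||y Hy].
- exact: alpha0_in.
- by apply: lamRH => //; apply: alpha0_in.
rewrite -(alpha0E _ Kc' y Hy) lam_conj !autEM (alpha0E _ Ka) //.
  by rewrite !autM autV autKV.
by apply: aut_stable_inv => // z; apply: lamH.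
Qed.

(** Let a' be the o-conjugate of a by b. Then a' o b = b o a reads a' u b u^-1 = b lambda_b(a) with
    u = lambda_b(alpha_a), and solving for a' gives the formula for A_b. *)
Let A_E b a : sgval (A_ sigma tau alpha a b) = conj_circ b a.
Proof.
have Kc' : conj_circ b a \in K by apply: nKc; apply: subgP.
rewrite /A_ sgM tauE stE sgV sgM !alphaE.
have : circ B (conj_circ b a) (sgval b) = circ B (sgval b) (sgval a).
  by rewrite /conj_circ -circA circVx circx1.
rewrite !circ_lambda (alpha0E _ Kc' _ (subgP b)) alpha_conj.
rewrite autM autV.
set u := lambda B _ (alpha0 _) => e.
apply: (mulIg (u * sgval b * u^-1)); rewrite e.
by rewrite !mulgA mulgKV mulgKV mulgK.
Qed.

Let decomposition_lift : lift_conditions sigma B1 tau alpha.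
Proof.
split.
- move=> a b; apply: autP => x; apply: subg_inj; rewrite !autEM.
  by rewrite sub_lambdaE !sigmaE sub_lambdaE lambda_conj ?subgP.
- move=> b c; apply: (mulIg (tau b)); rewrite mulgKV.
  apply: autP => x; apply: subg_inj; rewrite !autEM !(tauE, sigmaE) !sgM sgV.
  by rewrite sub_lambdaE !autM autV !invMg invgK !mulgA !mulgKV.
- move=> a a'; apply: subg_inj; rewrite sgM sub_lambdaE !alphaE sub_circE.
  have [Ka Ka'] := (subgP a, subgP a').
  have Kaa : circ B (sgval a) (sgval a') \in K.
    by rewrite circ_lambda groupM ?lamK.
  (* On H, lambda_a lambda_a' is conjugation by lambda_a(alpha_a') alpha_a, whose two factors
     commute since K is abelian. *)
  apply: commg_inner_uniq => [||y Hy]; first exact: alpha0_in.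
    by rewrite groupM ?lamRK ?alpha0_in.
  rewrite -(alpha0E _ Kaa y Hy) lambdaM autEM (alpha0E _ Ka' y Hy).
  rewrite !autM autV (alpha0E _ Ka y Hy).
  have Ku := RK _ (alpha0_in _ Ka).
  have Kl : lambda B (sgval a) (alpha0 (sgval a')) \in K.
    by rewrite lamK // RK ?alpha0_in.
  by rewrite (Kc _ _ Ku Kl) invMg !mulgA.
- by move=> a b; apply: subg_inj; rewrite stE !alphaE A_E alpha_conj.
(* On K the map s is lambda_b, so the last condition is the image under lambda of o-conjugation of a
   by b. *)
move=> a b; set s := (sigma b)^-1 * tau b.
have -> : s * lambda B1 a * (tau b)^-1 * sigma b = s * lambda B1 a * s^-1.
  by rewrite /s invMg invgK !mulgA.
have sE x : sgval (s x) = lambda B (sgval b) (sgval x) := stE b x.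
clearbody s; apply: (mulIg s); rewrite mulgKV.
apply: autP => x; apply: subg_inj.
by rewrite !autEM sub_lambdaE !sE sub_lambdaE A_E lam_conj !autEM autK.
Qed.

Lemma decomposition_iso :
  exists (N1 N2 : finGroupType)
      (sigma : {morphism [set: N2] >-> autType N1})
      (B1 : skew_brace N1) (B2 : skew_brace N2)
      (tau : {morphism [set: circ_group B2] >-> autType N1})
      (alpha : N1 -> N1) (L : lift_conditions sigma B1 tau alpha)
      (regG : regular_subgroup (G1_tilde L ><| G2_tilde L)),
    [/\ #|N1| = #|K|, abelian [set: N1], #|N2| = #|H|
      & skew_brace_iso B (brace_of_regular regG)].
Proof.
have abN1 : abelian [set: N1].
  by apply/centsP=> x _ y _; apply: subg_inj; rewrite !sgM Kc ?subgP.
pose L := decomposition_lift; pose rG := lift_regular abN1 L.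
exists N1, N2, sigma, B1, B2, tau, alpha, L, rG.
split=> //.
- by rewrite (card_isog (isog_subg K)) cardsT.
- by rewrite (card_isog (isog_subg H)) cardsT.
pose F (x : sdp sigma) := sgval (sd1 x) * sgval (sd2 x).
pose h z := SdpPair sigma (subg K (divgr K H z)) (subg H (remgr K H z)).
have inKH z : z \in K * H by rewrite KH inE.
have Fh : cancel h F.
  by move=> z; rewrite /F /= !subgK ?mem_divgr ?mem_remgr -?divgr_eq.
have hF : cancel F h.
  move=> [x1 x2]; rewrite /h /F /= (divgrMid tiKH) ?(remgrMid tiKH) ?subgP //.
  by rewrite !sgvalK.
have FM : {morph F : x y / x * y}.
  move=> [x1 x2] [y1 y2]; rewrite sdp_mulE /F.
  rewrite ![sd1 _]/= ![sd2 _]/= !sgM sigmaE.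
  by rewrite !mulgA mulgKV.
have F1x : F 1 = 1 by rewrite /F /= mulg1.
(* Transported along F, [lift2 b] and [lift1 a] become the left o-translations by b and a. Hence
   every g in G becomes a left o-translation, by F(sd1 g) as seen at 1, and F respects both
   operations. *)
have F2 (b : N2) (y : sdp sigma) :
    F (hol_act (lift2 L b) y) = circ B (sgval b) (F y).
  move: y => [z1 z2]; rewrite act_lift2 /F ![sd1 _]/= ![sd2 _]/= tauE.
  rewrite (sub_circE _ _ _ lamH).
  by rewrite !circ_lambda autM !mulgA mulgKV.
have F1 (a : N1) (y : sdp sigma) :
    F (hol_act (lift1 L a) y) = circ B (sgval a) (F y).
  move: y => [z1 z2]; rewrite act_lift1 /F ![sd1 _]/= ![sd2 _]/= !sgM sigmaE.
  rewrite sub_lambdaE alphaE sgV alphaE circ_lambda autM.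
  rewrite (alpha0E _ (subgP a) _ (subgP z2)) !mulgA mulgKV.
  congr (_ * _ * _); rewrite -!mulgA; congr (_ * _).
  by rewrite Kc // ?lamK ?subgP // RK ?alpha0_in ?subgP.
have Fact g y : g \in G1_tilde L ><| G2_tilde L ->
    F (hol_act g y) = circ B (F (sd1 g)) (F y).
  case/(G1_sdprod_G2P abN1) => b [a ->].
  by rewrite -hol_act1 !hol_actM !(F1, F2) F1x circr1 circA.
have Fc x y : F (circ (brace_of_regular rG) x y) = circ B (F x) (F y).
  have -> : circ (brace_of_regular rG) x y = hol_act (reg_elt rG x) y.
    by rewrite /hol_act reg_elt1.
  by rewrite Fact ?reg_elt1 // reg_elt_in.
exists h; split; first by exists F.
  by move=> x y; apply: (can_inj hF); rewrite FM !Fh.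
by move=> x y; apply: (can_inj hF); rewrite Fc !Fh.
Qed.
End Decomposition.

(** * A complement of K for both operations *)

(** Schur-Zassenhaus conjugacy compares complements of equal order, so Q is first cut down to its
    intersection with M L; by the modular law this complements M in M L, as L does. *)
Lemma sub_Hall_conj {gT : finGroupType} (M Q L : {group gT}) :
    solvable M -> Q \subset 'N(M) -> coprime #|M| #|L| ->
    L \subset M * Q -> M :&: Q = 1 ->
  exists2 x, x \in M & L \subset Q :^ x.
Proof.
move=> solM nMQ coML sLMQ tiMQ.
have nML : L \subset 'N(M).
  by apply: (subset_trans sLMQ); rewrite mul_subG ?normG.
have eML : M <*> L = M * L by rewrite norm_joinEr.
have eMR : M * (Q :&: M <*> L) = M * L.
  rewrite group_modl ?joing_subl //= eML; apply/setIidPr.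
  by apply: (subset_trans (mulgS M sLMQ)); rewrite mulgA mulGid.
have tiMR : M :&: (Q :&: M <*> L) = 1.
  by apply/trivgP; rewrite /= setIA tiMQ subsetIl.
have cR : #|L| = #|Q :&: M <*> L|.
  apply/eqP; rewrite -(eqn_pmul2l (cardG_gt0 M)) -(TI_cardMg tiMR) eMR.
  by rewrite (TI_cardMg (coprime_TIg coML)).
have nMR : (Q :&: M <*> L)%G \subset 'N(M) by rewrite subIset ?nMQ.
have sLMR : L \subset M * (Q :&: M <*> L)%G by rewrite eMR mulG_subr.
have coMR : coprime #|M| #|(Q :&: M <*> L)%G| by rewrite -cR.
have [x Mx eL] := SchurZassenhaus_trans_sol solM nMR sLMR coMR cR.
by exists x => //; rewrite eL conjSg subsetIl.
Qed.

Lemma hol_mulE {N : finGroupType} (x y : N) f g :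
  Hol x f * Hol y g = Hol (x * f y) (f * g).
Proof. by []. Qed.

Lemma hol_invE {N : finGroupType} (x : N) f :
  (Hol x f)^-1 = Hol (f^-1 x^-1) f^-1.
Proof. by []. Qed.

Section CommonComplement.
Variables (N : finGroupType) (B : skew_brace N) (K : {group N}).
Variable Hc : {group circ_group B}.
Hypotheses (solK : solvable K) (nK : K <| [set: N]).
Hypothesis lamK : forall a x, x \in K -> lambda B a x \in K.
Hypotheses (co : coprime #|K| #|Hc|) (cN : (#|K| * #|Hc|)%N = #|N|).

Let inM : {in [set: N] &, {morph (fun x => Hol x 1) : x y / x * y}}.
Proof. by move=> x y _ _; rewrite hol_mulE autE1 mulg1. Qed.
Let inN := Morphism inM.
Let lamM : {in [set: circ_group B] &,
  {morph (fun b : circ_group B => Hol 1 (lambda B b)) : b c / b * c}}.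
Proof.
move=> b c _ _; rewrite hol_mulE aut1 mulg1 -lambdaM; congr Hol.
Qed.
Let inL := Morphism lamM.
Let regM : {in [set: circ_group B] &,
  {morph (fun b : circ_group B => Hol (b : N) (lambda B b)) : b c / b * c}}.
Proof. by move=> b c _ _; rewrite hol_mulE -lambdaM -circ_lambda. Qed.
Let inR := Morphism regM.

(** [Lt] fixes 1, while [Rt] lies in the regular subgroup of B. Both are images of [Hc], so their
    orders are prime to that of K. *)
Let Nt := (inN @* [set: N])%G.
Let Kt := (inN @* K)%G.
Let Lt := (inL @* Hc)%G.
Let Rt := (inR @* Hc)%G.

Let inN_inj : 'injm inN.
Proof. by apply/injmP=> x y _ _ [->]. Qed.

Let mem_Nt x : Hol x 1 \in Nt.
Proof. by rewrite (mem_morphim inN) ?inE. Qed.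
Let mem_Kt x : x \in K -> Hol x 1 \in Kt.
Proof. by move=> Kx; rewrite (mem_morphim inN) ?inE. Qed.
Let mem_Lt b : b \in Hc -> Hol 1 (lambda B b) \in Lt.
Proof. by move=> Hb; rewrite (mem_morphim inL) ?inE. Qed.
Let KtP g : g \in Kt -> exists2 x, x \in K & g = Hol x 1.
Proof. by case/morphimP=> x _ Kx ->; exists x. Qed.

Let conj_Hol1 (f : autType N) x : Hol x 1 ^ (Hol 1 f)^-1 = Hol (f x) 1.
Proof.
rewrite conjgE invgK hol_invE !hol_mulE !invg1 !aut1 !mul1g !mulg1.
by rewrite mulgV.
Qed.

Let nNL : Lt \subset 'N(Nt).
Proof.
apply/subsetP=> _ /morphimP[b _ Hb ->]; rewrite -groupV inE.
by apply/subsetP=> _ /imsetP[_ /morphimP[x _ _ ->] ->]; rewrite conj_Hol1.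
Qed.

Let nKL : Lt \subset 'N(Kt).
Proof.
apply/subsetP=> _ /morphimP[b _ Hb ->]; rewrite -groupV inE.
apply/subsetP=> _ /imsetP[_ /morphimP[x _ Kx ->] ->]; rewrite conj_Hol1.
by rewrite mem_Kt ?lamK.
Qed.

Let nKN : Kt <| Nt.
Proof. exact: morphim_normal. Qed.

Let G := (Nt <*> Lt)%G.
Let GE : G = Nt * Lt :> {set _}.
Proof. exact: norm_joinEr. Qed.

Let nKG : Kt <| G.
Proof.
rewrite /normal (subset_trans (normal_sub nKN) (joing_subl _ _)) /=.
by rewrite join_subG normal_norm.
Qed.

Let cKt : #|Kt| = #|K|.
Proof. by rewrite (card_injm inN_inj) ?subsetT. Qed.
Let cNt : #|Nt| = #|N|.
Proof. by rewrite (card_injm inN_inj) ?cardsT. Qed.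

Let tiNL : Nt :&: Lt = 1.
Proof.
apply/trivgP/subsetP=> _ /setIP[/morphimP[x _ _ ->] /morphimP[b _ _ [-> _]]].
by rewrite inE.
Qed.

Let coKL : coprime #|Kt| #|Lt|.
Proof. by rewrite cKt coprime_morphr. Qed.
Let coKR : coprime #|Kt| #|Rt|.
Proof. by rewrite cKt coprime_morphr. Qed.

(** The index of [Kt] in [G] is |Hc| |Lt|, and |Lt| divides |Hc|. *)
Let hallK : Hall G Kt.
Proof.
rewrite /Hall (normal_sub nKG) -divgS ?(normal_sub nKG) //.
have -> : #|G| = (#|Kt| * (#|Hc| * #|Lt|))%N.
  by rewrite GE (TI_cardMg tiNL) cNt -cN cKt mulnA.
by rewrite mulKn ?cardG_gt0 // coprimeMr coKL cKt co.
Qed.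

Let solKt : solvable Kt.
Proof. exact: morphim_sol. Qed.

Let sRG : Rt \subset G.
Proof.
apply/subsetP=> _ /morphimP[b _ Hb ->]; rewrite GE.
apply/mulsgP; exists (Hol (b : N) 1) (Hol 1 (lambda B b)) => //.
  exact: mem_Lt.
by rewrite hol_mulE autE1 mulg1 mul1g.
Qed.

Let ex_compl : exists C : {group hol N}, exists2 y, y \in K &
  [/\ Kt :&: C = 1, Lt \subset C & Rt \subset C :^ Hol y 1].
Proof.
have /splitsP[C /complP[tiKC eG]] := SchurZassenhaus_split hallK nKG.
have nKC : C \subset 'N(Kt).
  by apply: subset_trans (normal_norm nKG); rewrite -eG mulG_subr.
(* The complement C is replaced by a conjugate containing [Lt]; [Rt] then lies in a further
   [Kt]-conjugate of that one. *)
have [|x Kx sLC] := sub_Hall_conj _ _ Lt solKt nKC coKL _ tiKC.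
  by rewrite eG joing_subr.
have tiKC' : Kt :&: C :^ x = 1.
  by rewrite -(conjGid Kx) -conjIg tiKC conjs1g.
have eG' : Kt * C :^ x = G.
  rewrite -{1}(conjGid Kx) -conjsMg eG conjGid //.
  exact: subsetP (normal_sub nKG) _ Kx.
have nKC' : (C :^ x)%G \subset 'N(Kt).
  by apply: subset_trans (normal_norm nKG); rewrite -eG' mulG_subr.
have [|y /KtP[g Kg ->] sRC] := sub_Hall_conj _ _ Rt solKt nKC' coKR _ tiKC'.
  by rewrite eG'.
by exists (C :^ x)%G, g.
Qed.

Lemma common_complement : exists2 H : {group N}, #|H| = #|Hc| &
  forall a x, a \in H -> x \in H -> lambda B a x \in H.
Proof.
have [C [g Kg [tiKC sLC sRC]]] := ex_compl.
(* The translations in C form an additive subgroup, which is stable under lambda(Hc) because C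
   contains [Lt]. *)
pose N2 := (inN @*^-1 C)%G.
have N2E x : (x \in N2) = (Hol x 1 \in C) by rewrite !inE.
have lamN2 b x : b \in Hc -> x \in N2 -> lambda B b x \in N2.
  move=> Hb; rewrite !N2E -conj_Hol1 => Cx.
  by rewrite groupJ // groupV (subsetP sLC) ?mem_Lt.
(* Conjugating (b, lambda_b) by (g, 1) gives an element of C; dividing it by (1, lambda_b), also in
   C, leaves a translation. *)
have hN2 b : b \in Hc -> g * circ B b g^-1 \in N2.
  move=> Hb; have : Hol (b : N) (lambda B b) \in Rt.
    by rewrite (mem_morphim inR) ?inE.
  move/(subsetP sRC); rewrite mem_conjg conjgE invgK hol_invE !hol_mulE.
  rewrite !autE1 invg1 autE1 mulg1 !mul1g => Cb.
  have := groupM Cb (groupVr (subsetP sLC _ (mem_Lt b Hb))).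
  rewrite N2E hol_invE hol_mulE invg1 !aut1 mulgV mulg1.
  by rewrite circ_lambda !mulgA.
(* The subgroup sought is the preimage of [N2] under the additive automorphism psi. *)
pose psi := lambda B g^-1.
have psiE x : psi x = g * circ B g^-1 x by rewrite mk_autE /lambda_fun invgK.
have memH x : (x \in [set z | psi z \in N2]) = (psi x \in N2).
  exact: in_set.
have gH : group_set [set x | psi x \in N2].
  apply/group_setP; split=> [|x y]; first by rewrite memH aut1 group1.
  by rewrite !memH autM => *; apply: groupM.
(* With k the o-inverse of g^-1, c b is the o-conjugate of b by k, and its    *)
(* image under psi is the first component of the conjugate of (b, lambda_b)   *)
(* by (g, 1) in the holomorph.                                                *)
pose c (b : circ_group B) : N := circ B (circ B (circ_inv B g^-1) b) g^-1.
have psi_c b : psi (c b) = g * circ B b g^-1.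
  by rewrite psiE /c !circA circxV circ1x.
have c_inj : injective c.
  pose d b := circ B (circ B g^-1 b) (circ_inv B g^-1).
  apply: (can_inj (g := d)) => b.
  by rewrite /d /c -!circA circxV circx1 circA circxV circ1x.
have tiKN2 : K :&: N2 = 1.
  apply/trivgP/subsetP=> x /setIP[Kx]; rewrite N2E => Cx.
  have : Hol x 1 \in Kt :&: C by rewrite inE mem_Kt.
  by rewrite tiKC => /set1P[->]; rewrite inE.
(* One inclusion is [hN2]; equality follows by counting, since [N2] meets K trivially and so has
   order at most |N| / |K| = |Hc|. *)
have eH : c @: Hc = [set x | psi x \in N2].
  apply/eqP; rewrite eqEcard; apply/andP; split.
    by apply/subsetP=> _ /imsetP[b Hb ->]; rewrite memH psi_c hN2.
  rewrite card_imset // (_ : [set x | _] = psi @^-1: N2); last first.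
    by apply/setP=> x; rewrite memH inE.
  rewrite card_preimset; last exact: perm_inj.
  rewrite -(leq_pmul2l (cardG_gt0 K)) cN -(TI_cardMg tiKN2).
  exact: max_card.
exists (group gH); first by rewrite /= -eH card_imset.
move=> a x /=; rewrite -{1}eH !memH => /imsetP[b Hb ->] Nx.
(* lambda of [c b] is psi^-1 lambda_b psi, which reduces the claim to the stability of [N2] under
   lambda(Hc). *)
have -> : psi (lambda B (c b) x) = lambda B b (psi x).
  by rewrite /psi /c !lambdaM !autEM lambda_circ_inv autKV.
exact: lamN2.
Qed.
End CommonComplement.

(** * Normal Hall subgroups of both groups, and the theorem *)

(** A normal Hall subgroup is a pi-core, hence characteristic. *)
Lemma normal_Hall_aut_stable {N : finGroupType} (K : {group N}) :
    K <| [set: N] -> Hall [set: N] K ->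
  forall (f : autType N) x, x \in K -> f x \in K.
Proof.
move=> nK /Hall_pi hallK f x Kx.
have /andP[_ /forall_inP/(_ _ (autvalP f))/subsetP] : K \char [set: N].
  by rewrite -(normal_Hall_pcore hallK nK) pcore_char.
by apply; apply: imset_f.
Qed.

(** Being stable under lambda, K is closed under o. It is then a pi-subgroup of (B, o), so it lies
    in the normal Hall subgroup M, and the orders agree. *)
Lemma normal_Hall_circ {N : finGroupType} (B : skew_brace N) (K : {group N})
    (M : {group circ_group B}) :
    (forall a x, x \in K -> lambda B a x \in K) ->
    M <| [set: circ_group B] -> Hall [set: circ_group B] M -> #|K| = #|M| ->
  forall x, (x \in K) = (x \in M).
Proof.
move=> lamK nM /Hall_pi hallM cKM x.
pose S := [set y : circ_group B | (y : N) \in K].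
have memS y : (y \in S) = ((y : N) \in K) by rewrite inE.
have gS : group_set S.
  apply/group_setP; split=> [|y z]; rewrite !memS.
    by rewrite [X in X \in _](circ_unit1 B) group1.
  by move=> Ky Kz; rewrite [X in X \in _]circ_lambda groupM ?lamK.
have cS : #|S| = #|K| by apply: eq_card => y; rewrite memS.
have sSM : group gS \subset M.
  rewrite (sub_normal_Hall hallM nM) ?subsetT //.
  by rewrite /pgroup /= cS cKM pnat_pi ?cardG_gt0.
have /eqP eSM : S == M by rewrite eqEcard sSM /= cS cKM.
by rewrite -memS eSM.
Qed.

Theorem theorem7 (m n : nat) (m_gt0 : 0 < m) (n_gt0 : 0 < n)
    (co_mn : coprime m n)
    (normal_m : forall (gT : finGroupType) (G : {group gT}),
       #|G| = (m * n)%N -> exists2 H : {group gT}, H <| G & #|H| = m) :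
  (forall (N1 N2 : finGroupType)
      (card_N1 : #|N1| = m) (abel_N1 : abelian [set: N1]) (card_N2 : #|N2| = n)
      (sigma : {morphism [set: N2] >-> autType N1})
      (B1 : skew_brace N1) (B2 : skew_brace N2)
      (tau : {morphism [set: circ_group B2] >-> autType N1})
      (alpha : N1 -> N1) (H : lift_conditions sigma B1 tau alpha),
    [/\ group_set (G1_tilde H),
        group_set (G2_tilde H),
        G2_tilde H \subset 'N(G1_tilde H)
      & regular_subgroup (G1_tilde H ><| G2_tilde H)])
  /\
  (forall (bT : finGroupType) (B : skew_brace bT) (K : {group bT})
      (card_B : #|bT| = (m * n)%N)
      (normal_K : K <| [set: bT]) (card_K : #|K| = m) (abel_K : abelian K),
    exists (N1 N2 : finGroupType)
      (sigma : {morphism [set: N2] >-> autType N1})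
      (B1 : skew_brace N1) (B2 : skew_brace N2)
      (tau : {morphism [set: circ_group B2] >-> autType N1})
      (alpha : N1 -> N1) (H : lift_conditions sigma B1 tau alpha)
      (regG : regular_subgroup (G1_tilde H ><| G2_tilde H)),
    [/\ #|N1| = m, abelian [set: N1], #|N2| = n
      & skew_brace_iso B (brace_of_regular regG)]).
Proof.
split=> [N1 N2 _ abN1 _ sigma B1 B2 tau alpha H|bT B K cB nK cK abK].
  split; [exact: G1_group_set | exact: G2_group_set | exact: G2_norm_G1
         | exact: lift_regular].
have hall_of (gT : finGroupType) (M : {group gT}) :
    #|gT| = (m * n)%N -> #|M| = m -> Hall [set: gT] M.
  move=> cT cM; rewrite /Hall subsetT -divgS ?subsetT //= cardsT cT cM.
  by rewrite mulKn.
have lamK a := normal_Hall_aut_stable K nK (hall_of _ K cB cK) (lambda B a).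
(* The hypothesis on groups of order mn is applied to (B, o); the subgroup M it provides turns out
   to have the same elements as K. *)
have [M nM cM] := normal_m (circ_group B) [set: circ_group B]%G
  (etrans (cardsT _) cB).
have hallM := hall_of _ M cB cM.
have KM := normal_Hall_circ B K M lamK nM hallM (etrans cK (esym cM)).
have /splitsP[Hc /complP[tiM eM]] := SchurZassenhaus_split hallM nM.
have cHc : #|Hc| = n.
  apply/eqP; rewrite -(eqn_pmul2l m_gt0) -[X in (X * _)%N]cM -(TI_cardMg tiM).
  by rewrite eM cardsT; apply/eqP.
have [H cH lamH] : exists2 H : {group bT}, #|H| = n &
    forall a x, a \in H -> x \in H -> lambda B a x \in H.
  rewrite -cHc; apply: (common_complement _ _ K) => //.
  - exact: abelian_sol.
  - by rewrite cK cHc.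
  - by rewrite cK cHc.
have co : coprime #|K| #|H| by rewrite cK cH.
have KH : K * H = [set: bT].
  apply/eqP; rewrite eqEcard subsetT /= cardsT (TI_cardMg (coprime_TIg co)).
  by rewrite cK cH cB.
have nKc a b : a \in K -> circ B (circ B b a) (circ_inv B b) \in K.
  rewrite !KM => Ma; have nMb : (b : circ_group B)^-1 \in 'N(M).
    by apply: (subsetP (normal_norm nM)); rewrite inE.
  by rewrite -(memJ_norm _ nMb) conjgE invgK mulgA in Ma.
rewrite -cK -cH; exact: decomposition_iso.
Qed.
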